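(* Let $\mathcal{T}_1,\dots,\mathcal{T}_T$ be an ensemble of decision trees, $S=\{(\mathbf{x}^{(i)},y^{(i)}): i=1,\dots,N\}$ a training sample with $K$ features, $c_1,\dots,c_K$ the feature costs and $\lambda$ the parameter weighting feature cost against error. Consider the integer program in the variables $z^{(t)}_h$ ($t\in[T]$, $h\in\mathcal{T}_t$), $w^{(t)}_{k,i}$ ($t\in[T]$, $k\in[K]$, $i\in[N]$) and $w_{k,i}$ ($k\in[K]$, $i\in[N]$): $$ \begin{array}{rll} \min & \displaystyle \frac{1}{NT}\sum_{t=1}^{T}\sum_{h\in\mathcal{T}_t} e^{(t)}_h z^{(t)}_h+\lambda\sum_{k=1}^{K}c_k\Big(\frac{1}{N}\sum_{i=1}^{N}w_{k,i}\Big) & \\ \text{s.t.} & z^{(t)}_h+\sum_{u\in p_t(h)}z^{(t)}_u=1 & \forall h\in\tilde{\mathcal{T}}_t,\ \forall t\in[T],\\ & z^{(t)}_h\in\{0,1\} & \forall h\in\mathcal{T}_t,\ \forall t\in[T],\\ & w^{(t)}_{k,i}+z^{(t)}_{u_{t,k,i}}+\sum_{h\in p_t(u_{t,k,i})}z^{(t)}_h=1 & \forall k\in K_{t,i},\ \forall i\in[N],\ \forall t\in[T],\\ & w^{(t)}_{k,i}\in\{0,1\} & \forall k\in[K],\ \forall i\in[N],\ \forall t\in[T],\\ & w^{(t)}_{k,i}\le w_{k,i} & \forall k\in[K],\ \forall i\in[N],\ \forall t\in[T],\\ & w_{k,i}\in\{0,1\} & \forall k\in[K],\ \forall i\in[N].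 \end{array} $$ Then the linear program relaxation of this integer program (each constraint ''$\in\{0,1\}$'' replaced by ''$\in[0,1]$'') has only integral optimal solutions.
   Context: Write $[n]=\{1,\dots,n\}$. Each tree $\mathcal{T}_t$ is a rooted decision tree, identified with its finite set of nodes; each internal node is associated with one feature in $[K]$, which is used to split the examples reaching that node among its children. Every example $i\in[N]$ is thereby routed along a unique root-to-leaf path in each (unpruned) tree $\mathcal{T}_t$. Notation: $\tilde{\mathcal{T}}_t$ is the set of leaves of $\mathcal{T}_t$. For a node $h\in\mathcal{T}_t$, $p_t(h)$ is the set of predecessors of $h$, i.e. the nodes other than $h$ on the path from the root to $h$. $S^{(t)}_h$ is the set of examples routed to or through $h$ in $\mathcal{T}_t$; $\text{Pred}^{(t)}_h$ is the class with the most training examples in $S^{(t)}_h$; $e^{(t)}_h=|\{i\in S^{(t)}_h: y^{(i)}\ne\text{Pred}^{(t)}_h\}|$ is the number of examples misclassified at $h$. $K_{t,i}\subseteq[K]$ is the set of features that example $i$ uses in $\mathcal{T}_t$, i.e. the features associated with some internal node on the root-to-leaf path followed by example $i$ in $\mathcal{T}_t$. For $k\in K_{t,i}$, $u_{t,k,i}$ is the first node (closest to the root) associated with feature $k$ on that path. Interpretation: $z^{(t)}_h=1$ means that $h$ is a leaf of the pruned version of $\mathcal{T}_t$; $w^{(t)}_{k,i}=1$ means that example $i$ uses feature $k$ in the pruned $\mathcal{T}_t$; $w_{k,i}$ indicates whether example $i$ uses feature $k$ in any of the $T$ pruned trees.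
   Formalization: ''Only integral optimal solutions'' is proved for optimal vertices (extreme points) of the relaxation, with existence of an optimal vertex; for all optimal solutions the claim is false, since ties between optima (e.g. λ=0, all errors 0) give fractional optimal solutions. *)

(* Defs.v *)
From mathcomp Require Import all_boot all_order all_algebra.

Set Implicit Arguments.
Unset Strict Implicit.
Unset Printing Implicit Defensive.

Import Order.TTheory GRing.Theory Num.Theory.

Local Open Scope ring_scope.

(* A finite rooted tree, given by its parent function; the root is its own
   parent, and it is the only such node because every node is led to it. *)
Record rtree := RTree {
  node :> finType;
  root : node;
  parent : node -> node;
  parent_root : parent root = root;
  parent_connect : forall h, fconnect parent h root
}.

Arguments root {r}.
Arguments parent {r} h.

Section RootedTree.
Variable t : rtree.
Implicit Types h u : t.

(* The root must be excluded, as it is its own parent but not its own child. *)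
Definition child h u := (u != root) && (parent u == h).

Definition internal h := [exists u, child h u].

Definition leaf h := ~~ internal h.

Definition predecessors h : {set t} :=
  [set u | (u != h) && fconnect parent h u].

Definition depth h := #|predecessors h|.

End RootedTree.

(* An example is a vector of K feature values in V.  At an internal node h, an
   example moves to the child selected by its value of [feature h].  The values
   of [feature] and [branch] at leaves are irrelevant and never used. *)
Record dtree (K : nat) (V : Type) := DTree {
  shape :> rtree;
  feature : shape -> 'I_K;
  branch : shape -> V -> shape;
  branch_child : forall h v, internal h -> child h (branch h v)
}.

Section DecisionTree.
Variables (K N : nat) (V : Type) (Y : finType) (t : dtree K V).
Variables (x : 'I_N -> 'I_K -> V) (y : 'I_N -> Y).
Implicit Types (h : t) (k : 'I_K) (i : 'I_N).

Definition route_step i h : t :=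
  if internal h then branch h (x i (feature h)) else h.

(* h lies on the root-to-leaf path of example i. *)
Definition on_path i h := fconnect (route_step i) root h.

Definition routed h : {set 'I_N} := [set i | on_path i h].

(* [a] is a class with the most examples in S_h; ties may be broken in any
   way, so this is a predicate rather than a choice of class. *)
Definition majority_class h (a : Y) :=
  forall b : Y, (#|[set i in routed h | y i == b]|
                 <= #|[set i in routed h | y i == a]|)%N.

Definition nb_errors (pred : t -> Y) h :=
  #|[set i in routed h | y i != pred h]|.

Definition on_path_with k i h :=
  [&& on_path i h, internal h & feature h == k].

Definition used_features i : {set 'I_K} :=
  [set k | [exists h, on_path_with k i h]].

(* The node u_{t,k,i}; it is the root (a dummy value) if k is not used by i. *)
Definition first_use k i : t :=
  [arg min_(h < root | on_path_with k i h) depth h].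

End DecisionTree.

Section PruningProgram.
Variables (R : realFieldType) (K N T : nat) (V : Type) (Y : finType).
Variable trees : 'I_T -> dtree K V.

(* The variables of the program; a point is a map from [var] to R. *)
Inductive var :=
  | Zv (t : 'I_T) (h : trees t)
  | Wtv (t : 'I_T) (k : 'I_K) (i : 'I_N)
  | Wv (k : 'I_K) (i : 'I_N).

Variables (x : 'I_N -> 'I_K -> V) (y : 'I_N -> Y).
Variable pred : forall t, trees t -> Y.
Variables (c : 'I_K -> R) (lambda : R).

Definition objective (p : var -> R) : R :=
  (N * T)%:R^-1 *
    (\sum_(t < T) \sum_(h : trees t)
       (nb_errors x y (@pred t) h)%:R * p (Zv h))
  + lambda * \sum_(k < K) c k * (N%:R^-1 * \sum_(i < N) p (Wv k i)).

(* The constraints, where [dom] is the domain of each single variable. *)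
Record feasible (dom : R -> Prop) (p : var -> R) : Prop := Feasible {
  leaf_constraint : forall (t : 'I_T) (h : trees t), leaf h ->
    p (Zv h) + \sum_(u in predecessors h) p (Zv u) = 1;
  Z_domain : forall (t : 'I_T) (h : trees t), dom (p (Zv h));
  use_constraint : forall (t : 'I_T) (i : 'I_N) (k : 'I_K),
    k \in used_features (trees t) x i ->
    p (Wtv t k i) + p (Zv (first_use (trees t) x k i))
    + \sum_(h in predecessors (first_use (trees t) x k i)) p (Zv h) = 1;
  Wt_domain : forall (t : 'I_T) (k : 'I_K) (i : 'I_N), dom (p (Wtv t k i));
  Wt_le_W : forall (t : 'I_T) (k : 'I_K) (i : 'I_N),
    p (Wtv t k i) <= p (Wv k i);
  W_domain : forall (k : 'I_K) (i : 'I_N), dom (p (Wv k i))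
}.

Definition ip_feasible := feasible (fun a => a = 0 \/ a = 1).

Definition lp_feasible := feasible (fun a => 0 <= a <= 1).

End PruningProgram.

Section Optimization.
Variables (R : realFieldType) (I : Type).
Implicit Types (P : (I -> R) -> Prop) (f : (I -> R) -> R) (p q r : I -> R).

Definition minimizer P f p := P p /\ forall q, P q -> f p <= f q.

(* An extreme point of P, that is, a basic feasible solution when P is a
   polyhedron. *)
Definition vertex P p :=
  P p /\ forall q r (a : R), P q -> P r -> 0 < a < 1 ->
    (forall j, p j = a * q j + (1 - a) * r j) -> q =1 r.

Definition integral p := forall j, exists m : int, p j = m%:~R.

End Optimization.

Lemma ip_feasibleE (R : realFieldType) (K N T : nat) (V : Type)
    (trees : 'I_T -> dtree K V) (x : 'I_N -> 'I_K -> V)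
    (p : var N trees -> R) :
  ip_feasible x p <-> lp_feasible x p /\ integral p.
Proof.
have dom01 (a : R) : a = 0 \/ a = 1 -> 0 <= a <= 1.
  by case=> ->; rewrite lexx ler01.
have int01 (a : R) : a = 0 \/ a = 1 -> exists m : int, a = m%:~R.
  by case=> ->; [exists 0 | exists 1].
have dom_int (a : R) : 0 <= a <= 1 -> (exists m : int, a = m%:~R) ->
    a = 0 \/ a = 1.
  move=> + [m am]; rewrite {}am ler0z lerz1.
  by case: m => [[|[|m]]|m] // _; [left | right].
split=> [[? ? ? ? ? ?]|[[? ? ? ? ? ?] int_p]].
  by split; [split=> *; auto | case=> *; auto].
by split=> *; auto.
Qed.

(* Main.v *)
(* Change coordinates: replace z_h by its sum s(h) along the path from the root
   to h, and w by s = 1 - w.  The feasible region becomes the set of all s in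
   [0,1] that equal 1 at the leaves, increase along the tree paths, satisfy
   s(w^t_{k,i}) = s(u_{t,k,i}) and s(w_{k,i}) <= s(w^t_{k,i}).  Only comparisons
   between coordinates occur, so the region is closed under s |-> phi o s for
   every nondecreasing phi of [0,1] fixing 0 and 1.
   - As a = (a^2 + (2a - a^2)) / 2, a vertex satisfies s^2 = 2s - s^2, so its
     coordinates s are 0 or 1.
   - If v is the least positive value of s and v < 1, then s = v phi(s) +
     (1 - v) psi(s) with phi(a) = [a > 0] and psi(a) = max(0, (a - v) / (1 - v)).
     Here phi(s) is integral and psi(s) has fewer fractional coordinates, so by
     induction some integral point is at least as good as s.  Hence the best of
     the finitely many integral points is optimal, and it is a vertex because
     it is a vertex of the unit cube. *)

From HB Require Import structures.
From mathcomp Require Import all_boot all_order all_algebra.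
From mathcomp Require Import boolp ring lra.
Require Import Defs.

Import Order.TTheory GRing.Theory Num.Theory.

Local Open Scope ring_scope.

Set Implicit Arguments.
Unset Strict Implicit.
Unset Printing Implicit Defensive.

(** * Rooted trees: root paths and sums along them *)

Section RootedTreeTheory.
Variable t : rtree.
Implicit Types h u : t.

Lemma iter_parent_root n : iter n parent root = root :> t.
Proof. by elim: n => //= n ->; apply: parent_root. Qed.

Lemma fconnect_root u : fconnect parent (root : t) u -> u = root.
Proof. by move/iter_findex <-; rewrite iter_parent_root. Qed.

(** If [m] steps lead from [h] to the root, then [m] turns around the cycle return to [h] but also
    end at the root, which [parent] fixes. *)
Lemma parent_cycle_root n h : iter n.+1 parent h = h -> h = root.
Proof.
move=> cyc; have := iter_findex (parent_connect h).
set m := findex _ _ _ => hm.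
have cycM k : iter (n.+1 * k) parent h = h.
  by elim: k => [|k IHk]; rewrite ?muln0 // mulnS iterD IHk.
by rewrite -(cycM m) mulSn addnC iterD hm iter_parent_root.
Qed.

Lemma predecessors_root : predecessors (root : t) = set0.
Proof.
apply/setP=> u; rewrite !inE; apply/negP => /andP[u_root /fconnect_root].
by apply/eqP.
Qed.

Lemma parent_notin_predecessors h : h \notin predecessors h.
Proof. by rewrite inE eqxx. Qed.

Lemma predecessors_parent h :
  h != root -> predecessors h = parent h |: predecessors (parent h).
Proof.
move=> h_root; apply/setP=> u; rewrite !inE.
have -> : (u == parent h) || (u != parent h) && fconnect parent (parent h) u
    = fconnect parent (parent h) u.
  by case: eqVneq => //= ->; rewrite connect0.
apply/andP/idP => [[uh /iter_findex] | hu].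
  case: (findex _ _ _) => [/= hu|n]; first by rewrite hu eqxx in uh.
  by rewrite iterSr => <-; apply: fconnect_iter.
split; last exact: connect_trans (fconnect1 _ _) hu.
(* If [u] were [h], then [h] would be reachable from its own parent, hence on a cycle, hence the
   root. *)
apply: contraNneq h_root => uh; rewrite {}uh in hu.
apply/eqP/(@parent_cycle_root (findex parent (parent h) h)).
by rewrite iterSr iter_findex.
Qed.

(** A node of greatest depth below [h] is a leaf, since any child of it would be deeper. *)
Lemma leaf_below h : exists2 u, leaf u & fconnect parent u h.
Proof.
case: (@arg_maxnP _ h (fun u => fconnect parent u h) (@depth t)) => [|u uh umax].
  exact: connect0.
exists u => //; apply/existsP => -[v /andP[v_root /eqP vu]].
have /umax : fconnect parent v h.
  by apply: connect_trans (fconnect1 _ _) _; rewrite vu.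
rewrite /depth (predecessors_parent v_root) vu cardsU1.
by rewrite parent_notin_predecessors add1n /geq /= ltnn.
Qed.

Section PathSums.
Variable R : realFieldType.
Implicit Types z s : t -> R.

Definition path_sum z h := z h + \sum_(u in predecessors h) z u.

(** Inverse of [path_sum]. The root is its own parent, so it gets a separate case, with 0 as the
    value preceding it. *)
Definition increment s h := s h - (if h == root then 0 else s (parent h)).

Lemma sum_predecessors z h :
  \sum_(u in predecessors h) z u =
  if h == root then 0 else path_sum z (parent h).
Proof.
case: eqVneq => [->|h_root]; first by rewrite predecessors_root big_set0.
by rewrite predecessors_parent // big_setU1 ?parent_notin_predecessors.
Qed.

Lemma path_sumK z : increment (path_sum z) =1 z.
Proof. by move=> h; rewrite /increment -sum_predecessors addrK. Qed.

(** The increments telescope along the root path; induction on the distance to the root. *)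
Lemma incrementK s : path_sum (increment s) =1 s.
Proof.
move=> h; have := iter_findex (parent_connect h).
move: (findex parent h root) => m.
elim: m h => [|n IHn] h.
  move=> /= ->.
  by rewrite /path_sum predecessors_root big_set0 /increment eqxx subr0 addr0.
rewrite iterSr => /IHn hn.
by rewrite /path_sum sum_predecessors hn /increment subrK.
Qed.

Lemma path_sum_parent z h :
  (forall u, 0 <= z u) -> path_sum z (parent h) <= path_sum z h.
Proof.
move=> z_ge0; case: (eqVneq h root) => [->|h_root]; first by rewrite parent_root.
rewrite {2}/path_sum sum_predecessors (negPf h_root) lerDr; exact: z_ge0.
Qed.

(** Path sums do not decrease on the way to a leaf below [h], where they reach 1. *)
Lemma path_sum_le1 z h :
  (forall u, 0 <= z u) -> (forall u, leaf u -> path_sum z u = 1) ->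
  path_sum z h <= 1.
Proof.
move=> z_ge0 z_leaf; have [u u_leaf /iter_findex uh] := leaf_below h.
rewrite -(z_leaf u u_leaf) -{}uh; elim: (findex _ _ _) => //= n.
exact: le_trans (path_sum_parent _ z_ge0).
Qed.

End PathSums.
End RootedTreeTheory.

(** * Finiteness of the set of variables *)

Section Var.
Variables (K N T : nat) (V : Type) (trees : 'I_T -> dtree K V).

(** Coding [var] in a sum of finite types makes it finite, so that fractional coordinates can be
    counted and 0/1 points enumerated. *)
Definition var_sum : finType :=
  ({t : 'I_T & trees t} + 'I_T * 'I_K * 'I_N + 'I_K * 'I_N)%type.

Definition var_code (v : var N trees) : var_sum :=
  match v with
  | Zv t h => inl (inl (existT _ t h))
  | Wtv t k i => inl (inr (t, k, i))
  | Wv k i => inr (k, i)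
  end.

Definition var_decode (c : var_sum) : var N trees :=
  match c with
  | inl (inl (existT t h)) => Zv N h
  | inl (inr (t, k, i)) => Wtv trees t k i
  | inr (k, i) => Wv trees k i
  end.

Lemma var_codeK : cancel var_code var_decode.
Proof. by case. Qed.

HB.instance Definition _ := Finite.copy (var N trees) (can_type var_codeK).

End Var.

(** * Path-sum coordinates, in which the constraints become comparisons *)

Section Levels.
Variables (R : realFieldType) (K N T : nat) (V : Type) (Y : finType).
Variables (trees : 'I_T -> dtree K V) (x : 'I_N -> 'I_K -> V).
Implicit Types (p s : var N trees -> R).

Definition level p v :=
  match v with
  | Zv t h => path_sum (fun u : trees t => p (Zv N u)) h
  | _ => 1 - p v
  end.

Definition of_level s v :=
  match v with
  | Zv t h => increment (fun u : trees t => s (Zv N u)) h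
  | _ => 1 - s v
  end.

Lemma levelK : cancel level of_level.
Proof.
by move=> p; apply/funext => -[t h|t k i|k i] /=; rewrite ?path_sumK ?subKr.
Qed.

Lemma of_levelK : cancel of_level level.
Proof.
by move=> s; apply/funext => -[t h|t k i|k i] /=; rewrite ?incrementK ?subKr.
Qed.

(** [of_level] is affine, and the weights sum to 1, which absorbs the constant in [1 - s v]. *)
Lemma of_level_conv (a : R) s s1 s2 :
  (forall v, s v = a * s1 v + (1 - a) * s2 v) ->
  forall v, of_level s v = a * of_level s1 v + (1 - a) * of_level s2 v.
Proof.
move=> sE [t h|t k i|k i] /=; rewrite /increment sE; [|ring|ring].
by case: ifP => _; rewrite ?sE; ring.
Qed.

Record order_feasible s : Prop := OrderFeasible {
  level01 : forall v, 0 <= s v <= 1;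
  level_leaf : forall (t : 'I_T) (h : trees t), leaf h -> s (Zv N h) = 1;
  level_parent : forall (t : 'I_T) (h : trees t),
    s (Zv N (parent h)) <= s (Zv N h);
  level_use : forall (t : 'I_T) (i : 'I_N) (k : 'I_K),
    k \in used_features (trees t) x i ->
    s (Wtv trees t k i) = s (Zv N (first_use (trees t) x k i));
  level_W : forall (t : 'I_T) (k : 'I_K) (i : 'I_N),
    s (Wv trees k i) <= s (Wtv trees t k i)
}.

Lemma level_feasible p : lp_feasible x p -> order_feasible (level p).
Proof.
case=> p_leaf pZ p_use pWt p_le pW.
have pZ0 t (u : trees t) : 0 <= p (Zv N u) by case/andP: (pZ t u).
split=> [[t h|t k i|k i]|t h /p_leaf //|t h|t i k /p_use|t k i] /=.
- rewrite path_sum_le1 ?andbT //; last by move=> u /p_leaf.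
  by rewrite addr_ge0 ?sumr_ge0.
- by have := pWt t k i; lra.
- by have := pW k i; lra.
- exact: path_sum_parent.
- by rewrite -addrA => <-; rewrite [LHS]addrC addKr.
- by have := p_le t k i; lra.
Qed.

Lemma of_level_feasible s : order_feasible s -> lp_feasible x (of_level s).
Proof.
case=> s01 s_leaf s_parent s_use s_W.
split=> [t h /s_leaf <-|t h|t i k /s_use wE|t k i|t k i|k i] /=.
- exact: (incrementK (fun u : trees t => s (Zv N u))).
- rewrite /increment; have := s01 (Zv N h).
  case: ifP => _; first by rewrite subr0.
  by have := s01 (Zv N (parent h)); have := s_parent t h; lra.
- rewrite -addrA wE.
  by rewrite [X in _ + X](incrementK (fun u : trees t => s (Zv N u))) subrK.
- by have := s01 (Wtv trees t k i); lra.
- by have := s_W t k i; lra.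
- by have := s01 (Wv trees k i); lra.
Qed.

(** Monotonicity is asked on [0,1] only: [a ^+ 2] and [2 * a - a ^+ 2], to which this is applied,
    are not monotone on all of [R]. *)
Lemma order_feasible_comp (phi : R -> R) s :
  phi 0 = 0 -> phi 1 = 1 ->
  (forall a b, 0 <= a -> a <= b -> b <= 1 -> phi a <= phi b) ->
  order_feasible s -> order_feasible (phi \o s).
Proof.
move=> phi0 phi1 phi_homo [s01 s_leaf s_parent s_use s_W].
have s_ge0 v : 0 <= s v by case/andP: (s01 v).
have s_le1 v : s v <= 1 by case/andP: (s01 v).
split=> [v|t h /s_leaf sh|t h|t i k /s_use wE|t k i] /=.
- by rewrite -{1}phi0 -[X in _ && (_ <= X)]phi1 !phi_homo.
- by rewrite sh.
- exact: phi_homo.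
- by rewrite wE.
- exact: phi_homo.
Qed.

Definition level_integral s := forall v, s v = 0 \/ s v = 1.

Lemma of_level_integral s : level_integral s -> integral (of_level s).
Proof.
move=> s_int; pose b v : int := if s v == 0 then 0 else 1.
have {}s_int v : s v = (b v)%:~R.
  rewrite /b; case: (s_int v) => ->; rewrite ?eqxx ?oner_eq0 //.
case=> [t h|t k i|k i] /=; rewrite /increment s_int.
- case: ifP => _; first by exists (b (Zv N h)); rewrite subr0.
  by rewrite s_int -intrB; eexists.
- by rewrite -[1]/(1%:~R) -intrB; eexists.
- by rewrite -[1]/(1%:~R) -intrB; eexists.
Qed.

Lemma vertex_integral p : vertex (lp_feasible x) p -> integral p.
Proof.
case=> /level_feasible p_ord p_extreme.
pose phi (a : R) := a ^+ 2; pose psi (a : R) := 2 * a - a ^+ 2.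
have s_phi : order_feasible (phi \o level p).
  apply: order_feasible_comp => //; rewrite /phi ?expr0n ?expr1n //.
  by move=> a b a0 ab b1; nra.
have s_psi : order_feasible (psi \o level p).
  apply: order_feasible_comp => //; rewrite /psi; [ring|ring|].
  by move=> a b a0 ab b1; nra.
have /p_extreme E := of_level_feasible s_phi.
have {E} := E _ 2^-1 (of_level_feasible s_psi).
have half : 0 < (2^-1 : R) < 1 by lra.
move=> /(_ half) E.
have {}E : of_level (phi \o level p) = of_level (psi \o level p).
  apply/funext/E => v; rewrite -{1}(levelK p).
  by apply: of_level_conv => {}v; rewrite /= /phi /psi; field.
have {}E := can_inj of_levelK E.
rewrite -(levelK p); apply: of_level_integral => v.
have /eqP : level p v * (level p v - 1) = 0.
  by have := congr1 (@^~ v) E; rewrite /= /phi /psi; lra.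
by rewrite mulf_eq0 subr_eq0 => /orP[]/eqP; [left|right].
Qed.

(** * Rounding to 0/1 levels without increasing an affine function *)

Section Rounding.
Variable f : (var N trees -> R) -> R.
Hypothesis f_conv : forall (a : R) s s1 s2,
  (forall v, s v = a * s1 v + (1 - a) * s2 v) ->
  f s = a * f s1 + (1 - a) * f s2.

Lemma level_rounding s : order_feasible s ->
  exists s', [/\ order_feasible s', level_integral s' & f s' <= f s].
Proof.
pose frac s := [pred v | (s v != 0) && (s v != 1)].
have [n] := ubnP #|frac s|; elim: n s => // n IHn s /ltnSE frac_n s_ord.
have [v0 v0_frac|s_int] := pickP (frac s); last first.
  exists s; split=> // v; have := s_int v => /= /negbT.
  by rewrite negb_and !negbK => /orP[]/eqP; [left|right].
(* A positive coordinate is fractional or equal to 1, so the least fractional value is the least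
   positive one. *)
have [v v_frac v_min] := arg_minP s v0_frac.
have /andP[v_neq0 v_neq1] := v_frac.
have s01 := level01 s_ord.
have a_gt0 : 0 < s v by rewrite lt0r v_neq0; case/andP: (s01 v).
have a_lt1 : s v < 1 by rewrite lt_neqAle v_neq1; case/andP: (s01 v).
set a := s v in v_neq0 v_neq1 a_gt0 a_lt1 v_min.
have a1_gt0 : 0 < 1 - a by rewrite subr_gt0.
pose phi (b : R) : R := (0 < b)%R%:R.
pose psi (b : R) : R := Num.max 0 ((b - a) / (1 - a)).
have psi0 : psi 0 = 0.
  by apply/max_idPl; rewrite pmulr_lle0 ?invr_gt0 // sub0r oppr_le0 ltW.
have psi1 : psi 1 = 1 by rewrite /psi divff ?gt_eqF //; apply/max_idPr.
have s_phi : order_feasible (phi \o s).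
  apply: order_feasible_comp s_ord; rewrite /phi ?ltxx ?ltr01 // => b d _ bd _.
  by case: (ltP 0 b) => // b0; rewrite (lt_le_trans b0 bd).
have s_psi : order_feasible (psi \o s).
  apply: order_feasible_comp s_ord => // b d _ bd _.
  rewrite /psi ge_max le_max lexx le_max ler_pM2r ?invr_gt0 //.
  by rewrite lerD2r bd orbT.
have s_conv u : s u = a * (phi \o s) u + (1 - a) * (psi \o s) u.
  have [s0|s_neq0] := eqVneq (s u) 0.
    by rewrite /= s0 psi0 /phi ltxx !mulr0 addr0.
  have au : a <= s u.
    have [->|s_neq1] := eqVneq (s u) 1; first exact: ltW.
    by apply: v_min; rewrite /= s_neq0.
  rewrite /= /phi (lt_le_trans a_gt0 au) /psi.
  have /max_idPr -> : 0 <= (s u - a) / (1 - a).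
    by rewrite divr_ge0 ?subr_ge0 // ltW.
  by rewrite mulr1 mulrC divfK ?gt_eqF // addrC subrK.
have fE := f_conv s_conv.
(* [f s] is a weighted mean of the values at the two points, so one of these is at most [f s]. *)
have [phi_le|phi_gt] := leP (f (phi \o s)) (f s).
  exists (phi \o s); split=> // u.
  by rewrite /= /phi; case: (0 < s u); [right|left].
have psi_le : f (psi \o s) <= f s by nra.
have [|s' [s'_ord s'_int s'_le]] := IHn (psi \o s) _ s_psi.
  (* [psi] fixes 0 and 1, so no new fractional coordinate arises; it sends [a] to 0, so [v] is no
     longer fractional. *)
  apply: leq_trans frac_n; apply: proper_card; apply/properP; split.
    apply/subsetP => u; rewrite !inE /= => /andP[psi_neq0 psi_neq1].
    by apply/andP; split; [apply: contraNneq psi_neq0|apply: contraNneq psi_neq1]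
      => ->; rewrite ?psi0 ?psi1.
  by exists v; rewrite ?inE //= /psi subrr mul0r maxxx eqxx.
by exists s'; split=> //; apply: le_trans psi_le.
Qed.

Lemma level_minimizer :
  exists2 s, minimizer order_feasible f s & level_integral s.
Proof.
pose pt (b : {ffun var N trees -> bool}) v : R := (b v)%:R.
(* The 0/1 candidates are not empty: all levels equal to 1 means that every tree is pruned to its
   root. *)
have ones_ord : `[< order_feasible (pt [ffun=> true]) >].
  by apply/asboolP; split=> *; rewrite /pt !ffunE ?lexx ?ler01.
have [b /asboolP b_ord b_min] :=
  @arg_minP _ _ _ _ (fun b => `[< order_feasible (pt b) >]) (f \o pt) ones_ord.
exists (pt b) => [|v]; last by rewrite /pt; case: (b v); [right|left].
split=> // s /level_rounding[s' [s'_ord s'_int]]; apply: le_trans.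
have s'E : s' = pt [ffun v => s' v == 1].
  apply/funext => v; rewrite /pt ffunE.
  by case: (s'_int v) => ->; rewrite ?eqxx // eq_sym oner_eq0.
by rewrite s'E; apply: b_min; apply/asboolP; rewrite -s'E.
Qed.

End Rounding.

(** * Linearity of the objective, and integral points as vertices *)

Lemma objective_conv (y : 'I_N -> Y) (pred : forall t : 'I_T, trees t -> Y)
    (c : 'I_K -> R) (lambda a : R) p p1 p2 :
  (forall v, p v = a * p1 v + (1 - a) * p2 v) ->
  objective x y pred c lambda p =
    a * objective x y pred c lambda p1
    + (1 - a) * objective x y pred c lambda p2.
Proof.
move=> pE.
have errE : \sum_(t < T) \sum_(h : trees t)
      (nb_errors x y (@pred t) h)%:R * p (Zv N h) =
    a * (\sum_(t < T) \sum_(h : trees t)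
      (nb_errors x y (@pred t) h)%:R * p1 (Zv N h)) +
    (1 - a) * (\sum_(t < T) \sum_(h : trees t)
      (nb_errors x y (@pred t) h)%:R * p2 (Zv N h)).
  rewrite !mulr_sumr -big_split; apply: eq_bigr => t _ /=.
  rewrite !mulr_sumr -big_split; apply: eq_bigr => h _ /=.
  by rewrite pE; ring.
have costE : \sum_(k < K) c k * (N%:R^-1 * \sum_(i < N) p (Wv trees k i)) =
    a * (\sum_(k < K) c k * (N%:R^-1 * \sum_(i < N) p1 (Wv trees k i))) +
    (1 - a) * (\sum_(k < K) c k * (N%:R^-1 * \sum_(i < N) p2 (Wv trees k i))).
  rewrite !mulr_sumr -big_split; apply: eq_bigr => k _ /=.
  rewrite !mulr_sumr -big_split; apply: eq_bigr => i _ /=.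
  by rewrite pE; ring.
by rewrite /objective errE costE; ring.
Qed.

(** Each coordinate of [p] is an end of [0,1], and a mean with positive weights reaches an end only
    if both terms do. *)
Lemma integral_vertex p : lp_feasible x p -> integral p ->
  vertex (lp_feasible x) p.
Proof.
move=> p_feas p_int; split=> // q r a q_feas r_feas a01 pE v.
have dom01 p' : lp_feasible x p' -> 0 <= p' v <= 1.
  by case=> *; case: (v).
have /ip_feasibleE ip : lp_feasible x p /\ integral p by [].
have : p v = 0 \/ p v = 1 by case: ip => *; case: (v).
have := dom01 q q_feas; have := dom01 r r_feas; have := pE v.
move=> -> ? ? []; nra.
Qed.

End Levels.

(** Optimal solutions are taken to be vertices, since the midpoint of two distinct integral optima
    is optimal but fractional. The first half shows that an optimal vertex exists. *)
Theorem theorem4p2 (R : realFieldType) (K N T : nat) (V : Type) (Y : finType)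
    (trees : 'I_T -> dtree K V)
    (x : 'I_N -> 'I_K -> V) (y : 'I_N -> Y)
    (pred : forall t : 'I_T, trees t -> Y)
    (c : 'I_K -> R) (lambda : R)
    (N_gt0 : (0 < N)%N) (T_gt0 : (0 < T)%N)
    (pred_majority : forall (t : 'I_T) (h : trees t),
       majority_class x y h (pred t h)) :
  (exists p : var N trees -> R,
     minimizer (lp_feasible x) (objective x y pred c lambda) p /\
     vertex (lp_feasible x) p) /\
  (forall p : var N trees -> R,
     minimizer (lp_feasible x) (objective x y pred c lambda) p ->
     vertex (lp_feasible x) p ->
     integral p).
Proof.
split=> [|p _]; last exact: vertex_integral.
(* The function to be rounded is the objective composed with [of_level]. *)
have conv (a : R) s s1 s2 sE :=
  objective_conv x y pred c lambda (@of_level_conv R K N T V trees a s s1 s2 sE).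
have [s [s_ord s_min] s_int] := level_minimizer x conv.
have p_feas := of_level_feasible s_ord.
exists (of_level s); split; last first.
  exact: integral_vertex (of_level_integral s_int).
split=> // q /level_feasible q_ord.
by rewrite -(levelK q); apply: s_min.
Qed.
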